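(* Let $m\geq 3$ and let $Z_m$ be the directed cycle of length $m$. Then the magnitude homology $\mathrm{MH}_{*,*}(Z_m)$ and the bigraded path homology $\mathrm{PH}_{*,*}(Z_m)$ are both concentrated in bidegrees of the form $(2i,mi)$ and $(2i+1,mi+1)$ (with $i\geq 0$), in each of which $\mathrm{MH}$ is a free $R$-module of rank $m$ and $\mathrm{PH}$ is a free $R$-module of rank $1$. Moreover, the magnitude-path spectral sequence of $Z_m$ satisfies $E^2(Z_m)=\cdots=E^{m-1}(Z_m)$, while $E^m(Z_m)$ is trivial, consisting of a single copy of $R$ in bidegree $(0,0)$.
   Context: Fix a commutative ground ring $R$. A directed graph $G$ has a vertex set $V(G)$ and edge set $E(G)\subseteq V(G)\times V(G)$. The distance $d(x,y)\in\{0,1,\dots,\infty\}$ is the minimal number of edges in a directed path from $x$ to $y$. The directed cycle $Z_m$ has $m$ cyclically ordered vertices and a single directed edge between adjacent vertices, consistently oriented (edges $x\to x+1$ for $x\in\mathbb Z/m$). The reachability complex $\mathrm{RC}_*(G)$ has in degree $k$ the free $R$-module on tuples $(x_0,\dots,x_k)$ of vertices with consecutive entries distinct and $d(x_i,x_{i+1})<\infty$ for all $i$; its differential is $\partial(x_0,\dots,x_k)=\sum_{i=0}^k(-1)^i(x_0,\dots,\widehat{x_i},\dots,x_k)$, omitting terms with repeated consecutive entries. The length of a tuple is $\ell(x_0,\dots,x_k)=\sum_i d(x_i,x_{i+1})$, and $F_\ell\mathrm{RC}_*(G)$ is spanned by tuples of length at most $\ell$. The magnitude-path spectral sequence $\{E^r_{*,*}(G),d^r\}_{r\geq0}$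 is the spectral sequence of this filtered complex, with $E^0_{i,j}(G)=F_i\mathrm{RC}_{i+j}(G)/F_{i-1}\mathrm{RC}_{i+j}(G)$ and $d^r$ of bidegree $(-r,r-1)$. Magnitude homology is $\mathrm{MH}_{k,\ell}(G)=E^1_{\ell,k-\ell}(G)$ and bigraded path homology is $\mathrm{PH}_{k,\ell}(G)=E^2_{\ell,k-\ell}(G)$. *)

(* Defs.v *)
From HB Require Import structures.
From mathcomp Require Import all_boot all_order all_algebra.
From mathcomp Require Import generic_quotient ring_quotient.
From mathcomp Require Import boolp.

Set Implicit Arguments.
Unset Strict Implicit.
Unset Printing Implicit Defensive.

Import Order.TTheory GRing.Theory Num.Theory.

Local Open Scope ring_scope.

Section Subquotient.
Variables (R : pzRingType) (V : lmodType R) (Z B : submodClosed V).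

Record numer := Numer { numer_val :> V; _ : numer_val \in Z }.
HB.instance Definition _ := [isSub for numer_val].
HB.instance Definition _ := [Choice of numer by <:].
HB.instance Definition _ := [SubChoice_isSubLmodule of numer by <:].

Definition denom : {pred numer} := [pred z | numer_val z \in B].

Lemma denom_closed : submod_closed denom.
Proof.
have valP : linear (val : numer -> V) by exact: linearP.
split=> [|a u v uB vB]; rewrite !inE.
  have -> : numer_val 0 = 0 by exact: (raddf0 (val : numer -> V)).
  exact: rpred0.
by rewrite [numer_val _](valP a u v) rpredD // rpredZ.
Qed.
HB.instance Definition _ := GRing.isSubmodClosed.Build R numer denom denom_closed.

(* Z / (Z :&: B), which is Z / B as soon as B is contained in Z. *)
Definition subquotient : Type := Quotient.quot denom.
HB.instance Definition _ := GRing.Zmodule.on subquotient.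

Definition sq_pi (u : numer) : subquotient := (\pi_(Quotient.quot denom) u)%qT.
Definition sq_repr (x : subquotient) : numer := repr x.
Definition sq_scale (a : R) (x : subquotient) : subquotient :=
  sq_pi (a *: sq_repr x).

Lemma sq_reprK : cancel sq_repr sq_pi.
Proof. by move=> x; apply: reprK. Qed.

Lemma sq_piP (u v : numer) : (sq_pi u = sq_pi v) <-> (u - v \in denom).
Proof. by rewrite Quotient.idealrBE; split=> /eqP. Qed.

Lemma sq_piD : {morph sq_pi : u v / u + v}.
Proof. by move=> u v; apply: Quotient.pi_add. Qed.

Lemma sq_scale_pi a (u : numer) : sq_scale a (sq_pi u) = sq_pi (a *: u).
Proof. by apply/sq_piP; rewrite -scalerBr rpredZ //; apply/sq_piP/sq_reprK. Qed.

Lemma sq_scalerA a b x : sq_scale a (sq_scale b x) = sq_scale (a * b) x.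
Proof. by rewrite -[x]sq_reprK !sq_scale_pi scalerA. Qed.

Lemma sq_scale1r : left_id 1 sq_scale.
Proof. by move=> x; rewrite -[x]sq_reprK sq_scale_pi scale1r. Qed.

Lemma sq_scalerDr : right_distributive sq_scale +%R.
Proof.
move=> a x y; rewrite -[x]sq_reprK -[y]sq_reprK.
by rewrite -sq_piD !sq_scale_pi scalerDr sq_piD.
Qed.

Lemma sq_scalerDl x : {morph sq_scale^~ x : a b / a + b}.
Proof. by move=> a b; rewrite -[x]sq_reprK !sq_scale_pi scalerDl sq_piD. Qed.

HB.instance Definition _ := GRing.Zmodule_isLmodule.Build R subquotient
  sq_scalerA sq_scale1r sq_scalerDr sq_scalerDl.

End Subquotient.

Definition free_of_rank (R : pzRingType) (n : nat) (M : lmodType R) : Prop :=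
  exists f : {linear 'rV[R]_n -> M}, bijective f.

Definition zero_module (R : pzRingType) (M : lmodType R) : Prop :=
  forall x : M, x = 0.

(* Only graphs with finitely many vertices are considered. *)
Record digraph := Digraph { vertex :> finType; edge : rel vertex }.
Arguments edge {d}.

Definition has_walk (G : digraph) (x y : G) (n : nat) : bool :=
  [exists p : n.-tuple G, path edge x p && (last x p == y)].

(* [None] stands for the value ∞. *)
Definition dist (G : digraph) (x y : G) : option nat :=
  if pselect (exists n, has_walk x y n) is left h then Some (ex_minn h)
  else None.

(* Edges x -> x + 1, where ordS is the successor modulo m. *)
Definition directed_cycle (m : nat) : digraph :=
  @Digraph 'I_m (fun x y => y == ordS x).

(* The degree is an integer; a tuple of degree k >= 0 has k + 1 entries. *)
Definition nverts (n : int) : nat := if n is Posz k then k.+1 else 0.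

Definition reach_seq (G : digraph) (s : seq G) : bool :=
  (s != [::]) && sorted (fun x y => (x != y) && (dist x y != None)) s.

Definition reach_tuple (G : digraph) (n : int) : finType :=
  {s : (nverts n).-tuple G | reach_seq s}.

Definition verts (G : digraph) (n : int) (s : reach_tuple G n) : seq G :=
  val (val s).

Definition len (G : digraph) (n : int) (s : reach_tuple G n) : nat :=
  (\sum_(e <- zip (verts s) (behead (verts s))) odflt 0 (dist e.1 e.2))%N.

Definition del_nth (T : Type) (i : nat) (s : seq T) : seq T :=
  take i s ++ drop i.+1 s.

Section ReachabilityComplex.
Variables (R : comPzRingType) (G : digraph).

(* The tuple s is identified with the indicator function of s. *)
Definition RC (n : int) : lmodType R := {ffun reach_tuple G n -> R^o}.

(* If the i-th face of s is not an element of [reach_tuple G n'], this is 0. *)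
Definition face (n n' : int) (i : nat) (s : reach_tuple G n) : RC n' :=
  [ffun t => (verts t == del_nth i (verts s))%:R].

(* The component RC_n -> RC_n' of the differential of the graded module RC;
   it vanishes unless n' = n - 1.  Leaving n' free avoids casts between
   n + 1 - 1 and n. *)
Definition bd (n n' : int) (c : RC n) : RC n' :=
  \sum_(s : reach_tuple G n)
    c s *: \sum_(i < nverts n) (-1) ^+ i *: face n' i s.

Lemma bd_is_linear n n' : linear (@bd n n').
Proof.
move=> a u v; rewrite /bd scaler_sumr -big_split /=.
by apply: eq_bigr => s _; rewrite !ffunE scalerDl scalerA.
Qed.
HB.instance Definition _ n n' :=
  GRing.isLinear.Build R (RC n) (RC n') *:%R (@bd n n') (@bd_is_linear n n').

Definition filt (p n : int) : {pred RC n} :=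
  [pred c : RC n | [forall s, (c s != 0) ==> ((len s)%:Z <= p)]].

Arguments filt p {n}.

Lemma filt_closed p n : submod_closed (@filt p n).
Proof.
split=> [|a u v /forallP uF /forallP vF]; apply/forallP => s.
  by rewrite ffunE eqxx.
apply/implyP; rewrite !ffunE => nz.
have [us0|us] := eqVneq (u s) 0; last exact: (implyP (uF s)).
have [vs0|vs] := eqVneq (v s) 0; last exact: (implyP (vF s)).
by rewrite us0 vs0 scaler0 addr0 eqxx in nz.
Qed.
HB.instance Definition _ p n :=
  GRing.isSubmodClosed.Build R (RC n) (@filt p n) (@filt_closed p n).

(* In terms of Z^r_p = {z in F_p | bd z in F_{p-r}}, and inside F_p / F_{p-1},
     E^r_p = (Z^r_p + F_{p-1}) / (bd Z^{r-1}_{p+r-1} + F_{p-1}).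
   With these representatives every page is a subquotient of one and the same
   module, numerators decrease with r, denominators increase with r, and
   E^{r+1} = E^r means that both are unchanged, i.e. that d^r = 0.  The
   denominator lies in the numerator because bd \o bd = 0. *)
Definition ss_num (r : nat) (p n : int) : {pred RC n} :=
  [pred c : RC n | `[< exists z w : RC n,
     [/\ z \in filt p, bd (n - 1) z \in filt (p - r%:Z),
         w \in filt (p - 1) & c = z + w] >]].

Definition ss_den (r : nat) (p n : int) : {pred RC n} :=
  [pred c : RC n | `[< exists (z : RC (n + 1)) (w : RC n),
     [/\ z \in filt (p + r%:Z - 1), bd n z \in filt p,
         w \in filt (p - 1) & c = bd n z + w] >]].

Lemma ss_num_closed r p n : submod_closed (@ss_num r p n).
Proof.
split=> [|a u v /asboolP[z [w [zF dzF wF ->]]] /asboolP[z' [w' [zF' dzF' wF' ->]]]];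
  apply/asboolP.
  by exists 0, 0; rewrite linear0 addr0 !rpred0.
exists (a *: z + z'), (a *: w + w'); rewrite linearP.
by split; rewrite ?rpredD ?rpredZ // scalerDr addrACA.
Qed.
HB.instance Definition _ r p n :=
  GRing.isSubmodClosed.Build R (RC n) (@ss_num r p n) (@ss_num_closed r p n).

Lemma ss_den_closed r p n : submod_closed (@ss_den r p n).
Proof.
split=> [|a u v /asboolP[z [w [zF dzF wF ->]]] /asboolP[z' [w' [zF' dzF' wF' ->]]]];
  apply/asboolP.
  by exists 0, 0; rewrite linear0 addr0 !rpred0.
exists (a *: z + z'), (a *: w + w'); rewrite linearP.
by split; rewrite ?rpredD ?rpredZ // scalerDr addrACA.
Qed.
HB.instance Definition _ r p n :=
  GRing.isSubmodClosed.Build R (RC n) (@ss_den r p n) (@ss_den_closed r p n).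

Definition SS (r : nat) (i j : int) : lmodType R :=
  subquotient (@ss_num r i (i + j)) (@ss_den r i (i + j)).

Definition MH (k l : int) : lmodType R := SS 1 l (k - l).
Definition PH (k l : int) : lmodType R := SS 2 l (k - l).

End ReachabilityComplex.

Arguments ss_num R G r p n : clear implicits.
Arguments ss_den R G r p n : clear implicits.

(* Main.v *)
(* In degree k let C_k = R^m, with differentials C_{k+1} -> C_k alternating
   between t - 1 (k even) and the norm N (k odd), where t is the rotation of
   Z_m: this is the periodic resolution of R over the group ring of Z/m.  Place
   C_k in the single filtration level m * (k / 2) + (k mod 2).  The reachability
   complex of Z_m retracts onto C by filtered maps and a filtered homotopy:
   prefixing a fixed vertex x contracts the reachability complex, C has a
   matching contraction for each x, and the projection, the inclusion and the
   homotopy are obtained from these contractions by recursion on the first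
   vertex; they respect lengths by the triangle inequality.  Hence from E^1 on
   the pages are those of C.  There t - 1 lowers the level by 1 and N lowers it
   by m - 1, so only d^1 and d^(m-1) are nonzero, and exactness of C leaves one
   copy of R in degree 0. *)
From HB Require Import structures.
Require Import Defs.
From mathcomp Require Import all_boot all_order all_algebra.
From mathcomp Require Import boolp zify ring.

Set Implicit Arguments.
Unset Strict Implicit.
Unset Printing Implicit Defensive.

Import Order.TTheory GRing.Theory Num.Theory.

Local Open Scope ring_scope.

(** * Distances in a directed cycle *)

Section CycleDistance.
Variable m : nat.
Implicit Types x y z : 'I_m.

Definition cdist x y : nat := (if x <= y then y - x else m + y - x)%N.

Lemma cdistP x y :
  (cdist x y < m)%N /\ (x + cdist x y = y \/ x + cdist x y = y + m)%N.
Proof.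
rewrite /cdist; have := ltn_ord x; have := ltn_ord y.
by case: (leqP x y); lia.
Qed.

Lemma cdist_lt x y : (cdist x y < m)%N.
Proof. by have [] := cdistP x y. Qed.

Lemma cdistxx x : cdist x x = 0%N.
Proof. by have := cdistP x x; lia. Qed.

Lemma cdist_inj x : injective (cdist x).
Proof.
move=> y z E; apply: ord_inj; have := cdistP x y; rewrite E; have := cdistP x z.
by have := ltn_ord y; have := ltn_ord z; lia.
Qed.

Lemma cdist_eq0 x y : (cdist x y == 0%N) = (x == y).
Proof. by rewrite -(inj_eq (@cdist_inj x)) cdistxx eq_sym. Qed.

Lemma cdist_triangle y x z : (cdist x z <= cdist x y + cdist y z)%N.
Proof. by have := cdistP x z; have := cdistP x y; have := cdistP y z; lia. Qed.

Lemma ordSP x : (ordS x = x.+1 :> nat \/ ordS x + m = x.+1)%N.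
Proof.
have := ltn_ord x; rewrite leq_eqVlt /= => /orP[/eqP->|xm].
  by right; rewrite modnn.
by left; rewrite modn_small.
Qed.

Lemma ord_predP x : (x = (ord_pred x).+1 :> nat \/ x + m = (ord_pred x).+1)%N.
Proof. by have := ordSP (ord_pred x); rewrite ord_predK; lia. Qed.

Lemma cdist_pred x : cdist x (ord_pred x) = m.-1.
Proof. by have := ord_predP x; have := cdistP x (ord_pred x); lia. Qed.

Lemma cdist_ordS x : (cdist x (ordS x) <= 1)%N.
Proof.
by have := ordSP x; have := cdistP x (ordS x); have := ltn_ord (ordS x); lia.
Qed.

Lemma cdist_pred_lt x y : x != y -> cdist x y = (cdist x (ord_pred y)).+1.
Proof.
rewrite -cdist_eq0 => /eqP; have := ord_predP y; have := cdistP x y.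
by have := cdistP x (ord_pred y); lia.
Qed.

(** Each vertex has a single outgoing edge, so a walk is determined by its start and its length. *)
Lemma has_walk_cycle x y n :
  has_walk (G := directed_cycle m) x y n = (iter n (@ordS m) x == y).
Proof.
elim: n x => [|n IH] x.
  apply/existsP/idP => [[p]|/= xy]; first by rewrite [p]tuple0.
  by exists [tuple].
rewrite iterSr -IH; apply/existsP/existsP => [[p]|[p Hp]].
  case/tupleP: p => z p /= /andP[/andP[/eqP -> pz] l].
  by exists p; rewrite pz.
by exists [tuple of ordS x :: p]; rewrite /= eqxx.
Qed.

Lemma cdist_iter x y : iter (cdist x y) (@ordS m) x = y.
Proof.
move dxy: (cdist x y) => n; elim: n y dxy => [|n IH] y dxy.
  by apply/eqP; rewrite -cdist_eq0 dxy.
have xy : x != y by rewrite -cdist_eq0 dxy.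
move: dxy; rewrite (cdist_pred_lt xy) => -[/IH /= ->].
exact: ord_predK.
Qed.

Lemma cdist_iter_le x n : (cdist x (iter n (@ordS m) x) <= n)%N.
Proof.
elim: n => [|n IH]; first by rewrite /= cdistxx.
rewrite iterS; apply: leq_trans (cdist_triangle (iter n (@ordS m) x) _ _) _.
by rewrite -addn1 leq_add // cdist_ordS.
Qed.

Lemma dist_cycle x y : dist (G := directed_cycle m) x y = Some (cdist x y).
Proof.
rewrite /dist; case: pselect => [h|[]]; last first.
  by exists (cdist x y); rewrite has_walk_cycle cdist_iter.
case: ex_minnP => n; rewrite has_walk_cycle => /eqP <- nmin; congr Some.
apply/eqP; rewrite eqn_leq cdist_iter_le andbT; apply: nmin.
by rewrite has_walk_cycle cdist_iter.
Qed.

Lemma reach_seq_cycle (s : seq (directed_cycle m)) :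
  reach_seq (G := directed_cycle m) s
  = (s != [::]) && sorted (fun x y => x != y) s.
Proof.
congr (_ && _); case: s => //= x s; elim: s x => //= y s IH x.
by rewrite dist_cycle andbT IH.
Qed.

Definition slen (s : seq (directed_cycle m)) : nat :=
  (\sum_(e <- zip s (behead s)) cdist e.1 e.2)%N.

Lemma slen1 (x : directed_cycle m) : slen [:: x] = 0%N.
Proof. by rewrite /slen big_nil. Qed.

Lemma slen_cons (x y : directed_cycle m) s :
  slen [:: x, y & s] = (cdist x y + slen (y :: s))%N.
Proof. by rewrite /slen big_cons. Qed.

Lemma lenE n (t : reach_tuple (directed_cycle m) n) : len t = slen (verts t).
Proof. by apply: eq_bigr => e _; rewrite dist_cycle. Qed.

End CycleDistance.

(** * The periodic complex *)

Section SmallComplex.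
Variables (R : comPzRingType) (m : nat).
Implicit Types (k : nat) (x y z : 'I_m) (f g : 'rV[R]_m).

(* The differential C_{k+1} -> C_k. *)
Definition small_bd k f : 'rV[R]_m :=
  \row_z if odd k then \sum_y f 0 y else f 0 (ord_pred z) - f 0 z.

(* The contraction C_k -> C_{k+1} at x.  For k even it sends the basis vector y
   to the sum of the vertices met on the way from x to y, y excluded; for k odd
   it sends x - 1 to x and kills the other basis vectors. *)
Definition small_cone k x f : 'rV[R]_m :=
  \row_z if odd k then (z == x)%:R * f 0 (ord_pred x)
         else \sum_y (cdist x z < cdist x y)%:R * f 0 y.

Definition level k : nat := (m * k./2 + odd k)%N.

Lemma small_bd_is_linear k : linear (small_bd k).
Proof.
move=> a u v; apply/rowP=> z; rewrite !mxE; case: odd; last by ring.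
by rewrite mulr_sumr -big_split; apply: eq_bigr => y _; rewrite !mxE.
Qed.
HB.instance Definition _ k :=
  GRing.isLinear.Build R 'rV[R]_m 'rV[R]_m *:%R (small_bd k)
    (@small_bd_is_linear k).

Lemma small_cone_is_linear k x : linear (small_cone k x).
Proof.
move=> a u v; apply/rowP=> z; rewrite !mxE; case: odd; first by ring.
by rewrite mulr_sumr -big_split; apply: eq_bigr => y _; rewrite !mxE /=; ring.
Qed.
HB.instance Definition _ k x :=
  GRing.isLinear.Build R 'rV[R]_m 'rV[R]_m *:%R (small_cone k x)
    (@small_cone_is_linear k x).

Lemma sum_delta (F : 'I_m -> R) x : \sum_y (y == x)%:R * F y = F x.
Proof.
rewrite (bigD1 x) //= eqxx mul1r big1 ?addr0 // => y /negPf ->.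
by rewrite mul0r.
Qed.

Lemma sum_delta_mx x : \sum_y (delta_mx 0 x : 'rV[R]_m) 0 y = 1.
Proof.
rewrite -[RHS](sum_delta (fun=> 1) x); apply: eq_bigr => y _.
by rewrite mxE eqxx mulr1.
Qed.

Lemma sum_small_bd_even k f : ~~ odd k -> \sum_z (small_bd k f) 0 z = 0.
Proof.
move=> /negPf k_even; under eq_bigr do rewrite mxE k_even.
rewrite sumrB (reindex_inj (can_inj (@ordSK m))) /= -sumrB big1 // => z _.
by rewrite ordSK subrr.
Qed.

Lemma small_bd_bd k f : small_bd k (small_bd k.+1 f) = 0.
Proof.
apply/rowP => z; rewrite [LHS]mxE [RHS]mxE; case: ifP => kP.
  by rewrite sum_small_bd_even //= kP.
by rewrite !mxE /= kP /= subrr.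
Qed.

Lemma natr_ltnS (a b : nat) :
  (a < b)%N%:R - (a.+1 < b)%N%:R = (a.+1 == b)%:R :> R.
Proof.
rewrite [(a < b)%N]leq_eqVlt; case: eqP => [->|_] /=; last by rewrite subrr.
by rewrite ltnn subr0.
Qed.

(** Passing from [ord_pred z] to [z] raises the distance from [x] by one, so the difference of
    indicators singles out [y = z]. At [z = x] the distance falls from [m - 1] to 0 instead, and the
    correction term arises. *)
Lemma small_cone_bd_even x f z :
  (small_cone 0 x f) 0 (ord_pred z) - (small_cone 0 x f) 0 z
  = f 0 z - (z == x)%:R * \sum_y f 0 y.
Proof.
rewrite !mxE /= -sumrB; have [->|zx] := eqVneq z x.
  rewrite mul1r -[f 0 x](sum_delta (f 0)) -sumrB; apply: eq_bigr => y _.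
  rewrite cdist_pred cdistxx lt0n cdist_eq0 [x == y]eq_sym ltnNge.
  have -> : (cdist x y <= m.-1)%N by have := cdist_lt x y; lia.
  case: eqP => _ /=; ring.
rewrite mul0r subr0 -[f 0 z](sum_delta (f 0)); apply: eq_bigr => y _.
rewrite -mulrBl; congr (_ * _); rewrite -(inj_eq (@cdist_inj _ x)).
rewrite [cdist x z]cdist_pred_lt 1?eq_sym //.
by rewrite natr_ltnS eq_sym.
Qed.

Lemma small_cone_bd k x f :
  small_bd k.+1 (small_cone k.+1 x f) + small_cone k x (small_bd k f) = f.
Proof.
apply/rowP => z; rewrite mxE; case kP: (odd k).
  rewrite mxE /= kP /=.
  have -> : small_cone k.+1 x f = small_cone 0 x f.
    by apply/rowP=> y; rewrite !mxE /= kP.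
  by rewrite small_cone_bd_even !mxE kP; ring.
rewrite [X in X + _]mxE /= kP /=.
have -> : \sum_y (small_cone k.+1 x f) 0 y = f 0 (ord_pred x).
  under eq_bigr do rewrite mxE /= kP /=.
  exact: (sum_delta (fun=> f 0 (ord_pred x)) x).
rewrite mxE kP /=; under eq_bigr do rewrite mxE kP /= mulrBr.
rewrite sumrB (reindex_inj (can_inj (@ordSK m))) /= -sumrB.
under eq_bigr => y _ do rewrite ordSK -mulrBl.
(* Only [y = z] and the wrap-around vertex [y = ord_pred x] can contribute to this sum. *)
rewrite (bigD1 (ord_pred x)) //= ord_predK cdistxx ltn0 sub0r cdist_pred.
have [->|zx] := eqVneq z (ord_pred x).
  rewrite cdist_pred ltnn big1 ?oppr0; first by ring.
  have ltF w : (m.-1 < cdist x w)%N = false by have := cdist_lt x w; lia.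
  by move=> y _; rewrite !ltF subrr mul0r.
have dz : (cdist x z < m.-1)%N.
  rewrite ltn_neqAle -{1}(cdist_pred x) (inj_eq (@cdist_inj _ x)) zx /=.
  by have := cdist_lt x z; lia.
rewrite dz (bigD1 z) //= big1 ?addr0 => [|y /andP[yx yz]].
  rewrite (@cdist_pred_lt _ x (ordS z)) ?ordSK ?ltnSn ?ltnn /=.
    by ring.
  by apply: contraNneq zx => ->; rewrite ordSK.
rewrite (@cdist_pred_lt _ x (ordS y)) ?ordSK; last first.
  by apply: contraNneq yx => ->; rewrite ordSK.
rewrite ltnS leq_eqVlt (inj_eq (@cdist_inj _ x)) eq_sym (negPf yz) /=.
by rewrite subrr mul0r.
Qed.

Lemma small_cone_bd0 x f :
  small_bd 0 (small_cone 0 x f) = f - (\sum_y f 0 y) *: delta_mx 0 x.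
Proof.
by apply/rowP => z; rewrite mxE /= small_cone_bd_even !mxE mulrC eqxx /=.
Qed.

Hypothesis m_gt1 : (1 < m)%N.

Lemma ord_pred_neq x : ord_pred x != x.
Proof. by apply/eqP => E; have := ord_predP x; rewrite E; lia. Qed.

(** For [k] even the way from [x] to itself is empty. For [k] odd only [ord_pred x] survives, and it
    differs from [x] because [m > 1]. *)
Lemma small_cone_delta k x : small_cone k x (delta_mx 0 x) = 0.
Proof.
apply/rowP => z; rewrite !mxE; case: odd.
  by rewrite eqxx (negPf (ord_pred_neq x)) mulr0.
rewrite big1 // => y _; rewrite mxE eqxx /=; case: eqP => [->|_].
  by rewrite cdistxx mul0r.
by rewrite mulr0.
Qed.

Lemma small_cone_cone k x f : small_cone k.+1 x (small_cone k x f) = 0.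
Proof.
apply/rowP => z; rewrite !mxE /=; case kP: (odd k) => /=.
  apply: big1 => y _; rewrite mxE kP.
  by case: eqP => [->|_]; rewrite ?cdistxx ?mul0r ?mulr0.
rewrite big1 ?mulr0 // => y _.
by rewrite cdist_pred (_ : (m.-1 < _)%N = false) ?mul0r //;
  have := cdist_lt x y; lia.
Qed.

Lemma small_cone_bd_delta k x :
  small_cone k x (small_bd k (delta_mx 0 x)) = delta_mx 0 x.
Proof. by rewrite -[RHS](small_cone_bd k x) small_cone_delta linear0 add0r. Qed.

End SmallComplex.

(** * Reachability chains *)

Section Generators.
Variables (R : comPzRingType) (G : digraph).
Implicit Types (n : int) (s : seq G).

(** Arbitrary sequences are allowed, so that faces and prefixed tuples need no validity proof; those
    with repeated consecutive entries become 0, as in the differential. *)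
Definition gen n s : RC R G n := [ffun t => (verts t == s)%:R].

Lemma size_verts n (t : reach_tuple G n) : size (verts t) = nverts n.
Proof. exact: size_tuple. Qed.

Lemma reach_verts n (t : reach_tuple G n) : reach_seq (verts t).
Proof. exact: (valP t). Qed.

Lemma verts_inj n : injective (@verts G n).
Proof. by move=> s t /val_inj/val_inj. Qed.

Lemma vertsP n s : reach_seq s -> size s = nverts n ->
  exists t : reach_tuple G n, verts t = s.
Proof.
move=> s_reach /eqP s_size.
by exists (Sub (Tuple s_size) s_reach).
Qed.

Lemma gen_eq0 n s : ~~ (reach_seq s && (size s == nverts n)) -> gen n s = 0.
Proof.
move=> s_bad; apply/ffunP => t; rewrite !ffunE; case: eqP => // ts.
by rewrite -ts reach_verts size_verts eqxx in s_bad.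
Qed.

Lemma RC_gen n (c : RC R G n) : c = \sum_t c t *: gen n (verts t).
Proof.
apply/ffunP => t; rewrite sum_ffunE (bigD1 t) //= big1 => [|t' tt'].
  by rewrite !ffunE eqxx addr0 [RHS]mulr1.
by rewrite !ffunE (inj_eq (@verts_inj n)) eq_sym (negPf tt') scaler0.
Qed.

Lemma RC_ind n (P : RC R G n -> Prop) :
  P 0 -> (forall a u v, P u -> P v -> P (a *: u + v)) ->
  (forall s, reach_seq s -> size s = nverts n -> P (gen n s)) ->
  forall c, P c.
Proof.
move=> P0 PD Pgen c; rewrite [c]RC_gen; elim/big_rec: _ => // t d _ Pd.
by apply: PD => //; apply: Pgen; [apply: reach_verts | apply: size_verts].
Qed.

Section Extension.
Variables (n : int) (M : lmodType R) (phi : seq G -> M).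

Definition ext (c : RC R G n) : M := \sum_t c t *: phi (verts t).

Lemma ext_is_linear : linear ext.
Proof.
move=> a u v; rewrite /ext scaler_sumr -big_split /=.
by apply: eq_bigr => s _; rewrite !ffunE scalerDl scalerA.
Qed.
HB.instance Definition _ :=
  GRing.isLinear.Build R (RC R G n) M *:%R ext ext_is_linear.

Lemma ext_gen s : reach_seq s -> size s = nverts n -> ext (gen n s) = phi s.
Proof.
move=> s_reach s_size; have [t <-] := vertsP s_reach s_size.
rewrite /ext (bigD1 t) //= big1 => [|t' tt'].
  by rewrite ffunE eqxx scale1r addr0.
by rewrite ffunE (inj_eq (@verts_inj n)) (negPf tt') scale0r.
Qed.

End Extension.

(* A contraction by [bd_cone]; n' is free for the same reason as in [bd]. *)
Definition cone n n' (x : G) : RC R G n -> RC R G n' :=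
  ext (fun s => gen n' (x :: s)).
HB.instance Definition _ n n' x := GRing.Linear.on (@cone n n' x).

(** Written on sequences, the alternating sum also makes sense for degenerate tuples, so it can be
    expanded without asking whether a prefixed vertex repeats. *)
Definition bd_seq n s : RC R G n :=
  \sum_(i < size s) (-1) ^+ i *: gen n (del_nth i s).

Lemma bd_gen n n' s : reach_seq s -> size s = nverts n ->
  bd n' (gen n s) = bd_seq n' s.
Proof.
move=> s_reach s_size; rewrite /bd_seq s_size.
exact: (ext_gen (fun s =>
  \sum_(i < nverts n) (-1) ^+ i *: gen n' (del_nth i s))).
Qed.

Lemma bd_seq_cons n x s :
  bd_seq n (x :: s) =
  gen n s - \sum_(i < size s) (-1) ^+ i *: gen n (x :: del_nth i s).
Proof.
rewrite /bd_seq /= big_ord_recl expr0 scale1r /del_nth /= drop0 -sumrN.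
by congr (_ + _); apply: eq_bigr => i _; rewrite exprS mulN1r scaleNr.
Qed.

Definition aug n := ext (n := n) (M := R^o) (fun=> 1).
HB.instance Definition _ n := GRing.Linear.on (@aug n).

End Generators.

Arguments gen {R G} n s.
Arguments filt {R G} p {n}.
Arguments cone {R G n} n' x c.
Arguments bd_seq {R G} n s.

(** * Cones contract the augmented reachability complex *)

Section CycleChains.
Variables (R : comPzRingType) (m : nat).
Hypothesis m_gt1 : (1 < m)%N.
Local Notation Zm := (directed_cycle m).
Local Notation K k := (RC R Zm (Posz k)).
Implicit Types (k : nat) (s u v : seq Zm) (x y : Zm) (f : 'rV[R]_m).

Lemma gen_cons_diag (n : int) x s : gen n [:: x, x & s] = 0 :> RC R Zm n.
Proof. by apply: gen_eq0; rewrite reach_seq_cycle /= eqxx. Qed.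

Lemma cone_gen n n' x s : s != [::] -> nverts n' = (nverts n).+1 ->
  cone n' x (gen n s) = gen n' (x :: s) :> RC R Zm n'.
Proof.
move=> s_nil nn'; have [/andP[s_reach /eqP s_size]|bad] :=
  boolP (reach_seq s && (size s == nverts n)); first exact: ext_gen.
rewrite gen_eq0 // linear0 gen_eq0 //; apply: contra bad.
case: s s_nil => // y s _; rewrite !reach_seq_cycle /= => /andP[/andP[_ ->]].
by rewrite nn' eqSS.
Qed.

Lemma cone_cone n n' n'' x (c : RC R Zm n) : nverts n' = (nverts n).+1 ->
  nverts n'' = (nverts n').+1 -> cone n'' x (cone n' x c) = 0.
Proof.
move=> nn' nn''; elim/RC_ind: c => [|a u v Hu Hv|s]; first by rewrite !linear0.
  by rewrite !linearP /= Hu Hv scaler0 addr0.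
rewrite reach_seq_cycle => /andP[s_nil _] _.
by rewrite !cone_gen // gen_cons_diag.
Qed.

Lemma del_nth_neq_nil (T : eqType) i (s : seq T) :
  (1 < size s)%N -> del_nth i s != [::].
Proof.
move=> s_gt1; rewrite -size_eq0 size_cat size_take size_drop.
by case: ltnP; lia.
Qed.

Lemma cone_bd_seq k x s : (1 < size s)%N ->
  bd_seq k.+1 (x :: s) = gen k.+1 s - cone k.+1 x (bd_seq k s) :> K k.+1.
Proof.
move=> s_gt1; rewrite bd_seq_cons; congr (_ - _); rewrite /bd_seq linear_sum.
by apply: eq_bigr => i _; rewrite linearZ /= cone_gen // del_nth_neq_nil.
Qed.

Lemma bd_seq2 x y : bd_seq 0 [:: x; y] = gen 0 [:: y] - gen 0 [:: x] :> K 0.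
Proof. by rewrite bd_seq_cons big_ord1 expr0 scale1r. Qed.

Lemma cone_bd_seq_cons k x v : size v = k.+1 ->
  cone k.+1 x (bd_seq k (x :: v)) = gen k.+1 (x :: v) :> K k.+1.
Proof.
case: k => [|k] sv; last first.
  by rewrite cone_bd_seq ?sv // linearB /= cone_cone // subr0 cone_gen //
    -size_eq0 sv.
case: v sv => [|y []] //= _.
by rewrite bd_seq2 linearB /= !cone_gen // gen_cons_diag subr0.
Qed.

(** The first two faces cancel, and every other face still begins with [x] twice. *)
Lemma bd_seq_cons_diag k x v : size v = k -> bd_seq k [:: x, x & v] = 0 :> K k.
Proof.
case: k => [/size0nil->|k sv]; first by rewrite bd_seq2 subrr.
by rewrite cone_bd_seq /= ?sv // cone_bd_seq_cons // subrr.
Qed.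

Lemma bd_gen_cons k x s : reach_seq s -> size s = k.+1 ->
  bd k (gen k.+1 (x :: s)) = bd_seq k (x :: s) :> K k.
Proof.
case: s => // y s s_reach s_size; have [xy|xy] := eqVneq x y.
  by rewrite xy gen_cons_diag linear0 bd_seq_cons_diag //; case: s_size.
apply: bd_gen; last by rewrite /= -s_size.
by move: s_reach; rewrite !reach_seq_cycle /= xy.
Qed.

Lemma bd_cone k x (c : K k.+1) :
  bd k.+1 (cone k.+2 x c) = c - cone k.+1 x (bd k c).
Proof.
elim/RC_ind: c => [|a u v Hu Hv|s s_reach s_size].
- by rewrite !linear0 addr0.
- by rewrite !linearP /= Hu Hv scalerDr addrACA.
have [s_nil _] := andP s_reach.
by rewrite cone_gen // bd_gen_cons // cone_bd_seq ?s_size // bd_gen.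
Qed.

(** In degree 0 the augmentation takes the place of the next boundary. *)
Lemma bd_cone0 x (c : K 0) : bd 0 (cone 1 x c) = c - aug c *: gen 0 [:: x].
Proof.
elim/RC_ind: c => [|a u v Hu Hv|s s_reach s_size].
- by rewrite !linear0 scale0r subr0.
- by rewrite !linearP /= Hu Hv scalerDr addrACA scalerDl opprD scalerN scalerA.
case: s s_reach s_size => [|y []] // y_reach _.
by rewrite cone_gen // bd_gen_cons // bd_seq2 /aug ext_gen // scale1r.
Qed.

Lemma aug_bd (c : K 1) : aug (bd 0 c) = 0.
Proof.
elim/RC_ind: c => [|a u v Hu Hv|s s_reach s_size].
- by rewrite !linear0.
- by rewrite !linearP /= Hu Hv scaler0 addr0.
case: s s_reach s_size => [|x [|y []]] // s_reach _.
rewrite bd_gen // bd_seq2 linearB /= /aug !ext_gen ?subrr //.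
all: by rewrite reach_seq_cycle.
Qed.

Lemma gen_cone k s : reach_seq s -> size s = k.+2 ->
  exists x u, [/\ s = x :: u, reach_seq u, size u = k.+1
    & gen k.+1 s = cone k.+1 x (gen k u) :> K k.+1].
Proof.
case: s => [|x [|y u]] //; rewrite reach_seq_cycle /= => /andP[_ yu] [su].
exists x, (y :: u); rewrite reach_seq_cycle /= su yu; split=> //.
by rewrite cone_gen.
Qed.

(** A generator is a cone over a shorter one, so [bd_cone] reduces the claim to one degree lower;
    [aug_bd] starts the induction. *)
Lemma bd_bd k (c : K k.+2) : bd k (bd k.+1 c) = 0.
Proof.
elim: k c => [|k IH] c; elim/RC_ind: c => [|a u v Hu Hv|s s_reach s_size].
- by rewrite !linear0.
- by rewrite !linearP /= Hu Hv scaler0 addr0.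
- have [x [u [_ _ _ ->]]] := gen_cone s_reach s_size.
  by rewrite bd_cone linearB /= bd_cone0 aug_bd scale0r subr0 subrr.
- by rewrite !linear0.
- by rewrite !linearP /= Hu Hv scaler0 addr0.
have [x [u [_ _ _ ->]]] := gen_cone s_reach s_size.
by rewrite bd_cone linearB /= bd_cone IH linear0 subr0 subrr.
Qed.

(** * The projection onto the periodic complex *)

Fixpoint to_small_seq s : 'rV[R]_m :=
  if s is x :: u then
    if u is [::] then delta_mx 0 x
    else small_cone (size u).-1 x (to_small_seq u)
  else 0.

Definition to_small k : K k -> 'rV[R]_m := ext to_small_seq.
HB.instance Definition _ k := GRing.Linear.on (@to_small k).

Lemma to_small_gen k s : reach_seq s -> size s = k.+1 ->
  to_small (gen k s) = to_small_seq s.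
Proof. by move=> s_reach s_size; rewrite /to_small ext_gen. Qed.

Lemma to_small_seq_cons x s : s != [::] ->
  to_small_seq (x :: s) = small_cone (size s).-1 x (to_small_seq s).
Proof. by case: s. Qed.

(** Makes [to_small_cone] hold also where prefixing [x] repeats a vertex and the cone is 0. *)
Lemma small_cone_to_small_seq x s :
  small_cone (size s) x (to_small_seq (x :: s)) = 0.
Proof.
case: s => [|y s]; first exact: small_cone_delta.
by rewrite to_small_seq_cons //= small_cone_cone.
Qed.

Lemma to_small_cone k x (c : K k) :
  to_small (cone k.+1 x c) = small_cone k x (to_small c).
Proof.
elim/RC_ind: c => [|a u v Hu Hv|s s_reach s_size]; first by rewrite !linear0.
  by rewrite !linearP /= Hu Hv.
have [s_nil _] := andP s_reach; rewrite cone_gen // [in RHS]to_small_gen //.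
case: s s_reach s_size s_nil => // y s s_reach [s_size] _.
have [xy|xy] := eqVneq x y.
  by rewrite xy gen_cons_diag linear0 -s_size small_cone_to_small_seq.
rewrite to_small_gen; last by rewrite /= s_size.
  by rewrite to_small_seq_cons //= s_size.
by move: s_reach; rewrite !reach_seq_cycle /= xy.
Qed.

Lemma to_small_gen0 x : to_small (gen 0 [:: x]) = delta_mx 0 x.
Proof. by rewrite to_small_gen ?reach_seq_cycle. Qed.

Lemma sum_to_small0 (c : K 0) : \sum_y (to_small c) 0 y = aug c.
Proof.
elim/RC_ind: c => [|a u v Hu Hv|s s_reach s_size].
- by rewrite !linear0 big1 // => y _; rewrite mxE.
- rewrite linearP [RHS]linearP /= -Hu -Hv [X in _ = X + _]mulr_sumr -big_split.
  by apply: eq_bigr => y _; rewrite !mxE.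
case: s s_reach s_size => [|y []] // y_reach _.
by rewrite to_small_gen0 sum_delta_mx /aug ext_gen.
Qed.

(** As [to_small] carries [cone] to [small_cone], the two contraction identities reduce a generator
    to its tail. In degree 0 the augmentation matches the sum of coordinates. *)
Lemma to_small_bd k (c : K k.+1) : to_small (bd k c) = small_bd k (to_small c).
Proof.
elim: k c => [|k IH] c; elim/RC_ind: c => [|a u v Hu Hv|s s_reach s_size].
- by rewrite !linear0.
- by rewrite !linearP /= Hu Hv.
- have [x [u [_ _ _ ->]]] := gen_cone s_reach s_size.
  by rewrite bd_cone0 linearB linearZ /= to_small_gen0 to_small_cone
    small_cone_bd0 sum_to_small0.
- by rewrite !linear0.
- by rewrite !linearP /= Hu Hv.
have [x [u [_ _ _ ->]]] := gen_cone s_reach s_size.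
rewrite bd_cone linearB /= !to_small_cone IH.
by rewrite -[X in X - _](small_cone_bd k x) addrK.
Qed.

(** * The inclusion of the periodic complex *)

Fixpoint of_small_vec k x : K k :=
  if k is k'.+1 then
    cone k'.+1 x (\sum_y (small_bd k' (delta_mx 0 x)) 0 y *: of_small_vec k' y)
  else gen 0 [:: x].

Definition of_small k (f : 'rV[R]_m) : K k := \sum_y f 0 y *: of_small_vec k y.

Lemma of_small_is_linear k : linear (@of_small k).
Proof.
move=> a u v; rewrite /of_small scaler_sumr -big_split /=.
by apply: eq_bigr => y _; rewrite !mxE scalerDl scalerA.
Qed.
HB.instance Definition _ k :=
  GRing.isLinear.Build R 'rV[R]_m (K k) *:%R (@of_small k)
    (@of_small_is_linear k).

Lemma of_small_delta k x : of_small k (delta_mx 0 x) = of_small_vec k x.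
Proof.
rewrite /of_small (bigD1 x) //= big1 => [|y yx].
  by rewrite mxE !eqxx scale1r addr0.
by rewrite mxE (negPf yx) andbF scale0r.
Qed.

Lemma of_small_vec_S k x :
  of_small_vec k.+1 x = cone k.+1 x (of_small k (small_bd k (delta_mx 0 x))).
Proof. by []. Qed.

Lemma linear_eq_row (M : lmodType R) (A B : {linear 'rV[R]_m -> M}) :
  (forall x, A (delta_mx 0 x) = B (delta_mx 0 x)) -> A =1 B.
Proof.
move=> AB f; rewrite (row_sum_delta f) !linear_sum; apply: eq_bigr => x _.
by rewrite !linearZ AB.
Qed.

(** Pushing [to_small] through the cone leaves [small_cone] of the boundary of a basis vector, which
    is that vector again. *)
Lemma of_smallK k f : to_small (of_small k f) = f.
Proof.
elim: k f => [|k IH] f.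
  apply: (@linear_eq_row _ (@to_small 0 \o @of_small 0)%FUN idfun) => x /=.
  by rewrite of_small_delta to_small_gen0.
apply: (@linear_eq_row _ (@to_small k.+1 \o @of_small k.+1)%FUN idfun) => x /=.
by rewrite of_small_delta of_small_vec_S to_small_cone IH small_cone_bd_delta.
Qed.

(** The error term of [bd_cone] is a cone over the image of [small_bd] applied twice, hence 0; at
    the bottom it is the coordinate sum of a boundary. *)
Lemma bd_of_small k f : bd k (of_small k.+1 f) = of_small k (small_bd k f).
Proof.
elim: k f => [|k IH] f.
  apply: (@linear_eq_row _ (bd 0 \o @of_small 1)%FUN
    (@of_small 0 \o @small_bd R m 0)%FUN) => x /=.
  by rewrite of_small_delta of_small_vec_S bd_cone0 -sum_to_small0 of_smallK
    sum_small_bd_even // scale0r subr0.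
apply: (@linear_eq_row _ (bd k.+1 \o @of_small k.+2)%FUN
  (@of_small k.+1 \o @small_bd R m k.+1)%FUN) => x /=.
by rewrite of_small_delta of_small_vec_S bd_cone IH small_bd_bd !linear0 addr0.
Qed.

(** * The homotopy *)

Fixpoint htpy_seq k s : K k :=
  if k is k'.+1 then
    if s is x :: u then
      - cone k'.+1 x (of_small k' (to_small_seq s) + htpy_seq k' u)
    else 0
  else 0.

Lemma htpy_seq_cons k x u :
  htpy_seq k.+1 (x :: u)
    = - cone k.+1 x (of_small k (to_small_seq (x :: u)) + htpy_seq k u).
Proof. by []. Qed.

(* The recursion in [htpy_seq] is h c = cone x (c - G (F c) - h (bd c)) for c
   starting at x: all terms of h (bd c) starting at x, and c itself, are killed
   by [cone x], so only the face omitting x contributes. *)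
Definition htpy k : K k -> K k.+1 := ext (htpy_seq k.+1).
HB.instance Definition _ k := GRing.Linear.on (@htpy k).

Lemma htpy_gen k s : reach_seq s -> size s = k.+1 ->
  htpy (gen k s) = htpy_seq k.+1 s.
Proof. by move=> s_reach s_size; rewrite /htpy ext_gen. Qed.

(** [htpy] sends a tuple starting at [x] to a cone at [x], and coning twice at [x] gives 0. *)
Lemma cone_htpy_cone k x (c : K k) : cone k.+3 x (htpy (cone k.+1 x c)) = 0.
Proof.
elim/RC_ind: c => [|a u v Hu Hv|s s_reach s_size]; first by rewrite !linear0.
  by rewrite !linearP /= Hu Hv scaler0 addr0.
have [s_nil _] := andP s_reach; rewrite cone_gen //.
case: s s_reach s_size s_nil => // y s s_reach [s_size] _.
have [xy|xy] := eqVneq x y.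
  by rewrite xy gen_cons_diag !linear0.
rewrite htpy_gen; last by rewrite /= s_size.
  by rewrite [htpy_seq _ _]/= linearN /= cone_cone // oppr0.
by move: s_reach; rewrite !reach_seq_cycle /= xy.
Qed.

Lemma htpy0 (c : K 0) : htpy c = 0.
Proof.
elim/RC_ind: c => [|a u v Hu Hv|s s_reach s_size]; first by rewrite !linear0.
  by rewrite !linearP /= Hu Hv scaler0 addr0.
case: s s_reach s_size => [|x []] // x_reach _.
rewrite htpy_gen //= addr0 (of_small_delta 0) /= cone_gen // gen_cons_diag.
by rewrite oppr0.
Qed.

Lemma to_small0K (c : K 0) : of_small 0 (to_small c) = c.
Proof.
elim/RC_ind: c => [|a u v Hu Hv|s s_reach s_size]; first by rewrite !linear0.
  by rewrite !linearP /= Hu Hv.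
case: s s_reach s_size => [|x []] // x_reach _.
by rewrite to_small_gen0 of_small_delta.
Qed.

Lemma htpy_gen_cons k x u : reach_seq (x :: u) -> size u = k.+1 ->
  htpy (gen k.+1 (x :: u)) =
  - cone k.+2 x (of_small k.+1 (to_small (gen k.+1 (x :: u))) + htpy (gen k u)).
Proof.
move=> xu_reach u_size.
rewrite htpy_gen //= ?u_size // to_small_gen //= ?u_size //.
rewrite htpy_gen //; case: u xu_reach u_size => // y u.
by rewrite !reach_seq_cycle /= => /andP[].
Qed.

Lemma homotopy k (c : K k.+1) :
  c - of_small k.+1 (to_small c) = bd k.+1 (htpy c) + htpy (bd k c).
Proof.
elim: k c => [|k IH] c; elim/RC_ind: c => [|a u v Hu Hv|s s_reach s_size].
- by rewrite !linear0 !addr0.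
- by rewrite !linearP /= addrACA -scalerDr Hu Hv scalerDr addrACA.
- have [x [u [s_cons u_reach u_size s_cone]]] := gen_cone s_reach s_size.
  have -> : htpy (gen 1 s)
    = cone 2 x (gen 1 s - of_small 1 (to_small (gen 1 s))).
    rewrite [in LHS]s_cons htpy_gen_cons -?s_cons // htpy0 addr0.
    by rewrite linearB /= [in RHS]s_cone cone_cone // sub0r -s_cone.
  by rewrite bd_cone linearB /= bd_of_small -to_small_bd to_small0K subrr
    linear0 subr0 htpy0 addr0.
- by rewrite !linear0 !addr0.
- by rewrite !linearP /= addrACA -scalerDr Hu Hv scalerDr addrACA.
have [x [u [s_cons u_reach u_size s_cone]]] := gen_cone s_reach s_size.
have -> : htpy (gen k.+2 s) =
    cone k.+3 x (gen k.+2 s - of_small k.+2 (to_small (gen k.+2 s))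
                 - htpy (bd k.+1 (gen k.+2 s))).
  rewrite [in LHS]s_cons htpy_gen_cons -?s_cons // !linearB /=.
  rewrite [in RHS]s_cone cone_cone // sub0r -s_cone linearD opprD.
  congr (_ - _).
  by rewrite s_cone bd_cone !linearB /= cone_htpy_cone subr0.
(* The chain under the cone is a cycle: by induction its boundary is [htpy] of a twofold
   boundary. *)
rewrite bd_cone [X in cone _ _ X](_ : _ = 0) ?linear0 ?subr0 ?addr0 ?subrK //.
by rewrite 2!linearB /= bd_of_small -to_small_bd IH bd_bd linear0 addr0 subrr.
Qed.

(** * Length estimates for the projection, the inclusion and the homotopy *)

(* Bounding the length after x is prefixed, rather than the length, is what
   makes the recursive estimates go through. *)
Definition cfilt (x : Zm) p n : {pred RC R Zm n} :=
  [pred c : RC R Zm n |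
    [forall t, (c t != 0) ==> (slen (x :: verts t) <= p)%N]].
Arguments cfilt x p {n}.

Lemma cfiltP x p n (c : RC R Zm n) :
  reflect (forall t, c t != 0 -> (slen (x :: verts t) <= p)%N)
          (c \in cfilt x p).
Proof. by apply: (iffP forallP) => cP t; apply/implyP; apply: cP. Qed.

Lemma cfilt_closed x p n : submod_closed (@cfilt x p n).
Proof.
split=> [|a u v /cfiltP uP /cfiltP vP]; apply/cfiltP => t.
  by rewrite ffunE eqxx.
rewrite !ffunE; have [us0|us _] := eqVneq (u t) 0; last exact: uP.
by rewrite us0 scaler0 add0r; apply: vP.
Qed.
HB.instance Definition _ x p n :=
  GRing.isSubmodClosed.Build R (RC R Zm n) (@cfilt x p n) (@cfilt_closed x p n).

Lemma filtP (p n : int) (c : RC R Zm n) :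
  reflect (forall t, c t != 0 -> ((slen (verts t))%:Z <= p)) (c \in filt p).
Proof.
apply: (iffP forallP) => cP t; first by have := implyP (cP t); rewrite lenE.
by apply/implyP; rewrite lenE; apply: cP.
Qed.

Lemma filt_le (p q n : int) (c : RC R Zm n) :
  p <= q -> c \in filt p -> c \in filt q.
Proof. by move=> pq /filtP cP; apply/filtP => t /cP /le_trans; apply. Qed.

Lemma vertsE n (t : reach_tuple Zm n) : exists y u, verts t = y :: u.
Proof.
by have := reach_verts t; case: (verts t) => [|y u] // _; exists y, u.
Qed.

Lemma cfilt_filt x p n (c : RC R Zm n) : c \in cfilt x p -> c \in filt p%:Z.
Proof.
move=> /cfiltP cP; apply/filtP => t /cP; have [y [u ->]] := vertsE t.
by rewrite slen_cons lez_nat; apply: leq_trans; apply: leq_addl.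
Qed.

Lemma cfilt_move y x p q n (c : RC R Zm n) :
  (cdist y x + p <= q)%N -> c \in cfilt x p -> c \in cfilt y q.
Proof.
move=> pq /cfiltP cP; apply/cfiltP => t /cP; have [z [u ->]] := vertsE t.
by rewrite !slen_cons; have := cdist_triangle x y z; lia.
Qed.

Lemma cfilt_gen x p n s : (slen (x :: s) <= p)%N -> gen n s \in @cfilt x p n.
Proof.
move=> sp; apply/cfiltP => t; rewrite ffunE; case: (verts t =P s) => [->|] //.
by rewrite eqxx.
Qed.

Lemma slen_diag x s : slen (x :: x :: s) = slen (x :: s).
Proof. by rewrite slen_cons cdistxx. Qed.

Lemma cfilt_cone x p n n' (c : RC R Zm n) :
  c \in cfilt x p -> cone n' x c \in cfilt x p.
Proof.
move=> /cfiltP cP; rewrite /cone /ext; apply: rpred_sum => t _.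
have [->|/cP tP] := eqVneq (c t) 0; first by rewrite scale0r rpred0.
by rewrite rpredZ // cfilt_gen // slen_diag.
Qed.

Lemma level_S k : level m k.+1 = (level m k + if odd k then m.-1 else 1)%N.
Proof.
by rewrite /level /= uphalf_half; case: (odd k) => /=; rewrite ?addn0 //; nia.
Qed.

Lemma of_small_lincomb k x p f :
  (forall z, f 0 z != 0 -> of_small_vec k z \in cfilt x p) ->
  of_small k f \in cfilt x p.
Proof.
move=> fP; apply: rpred_sum => z _.
by have [->|/fP] := eqVneq (f 0 z) 0; [rewrite scale0r rpred0 | apply: rpredZ].
Qed.

Lemma cdist_le_pred x y : (cdist x y <= m.-1)%N.
Proof. by have := cdist_lt x y; lia. Qed.

(** The boundary of the basis vector at [x] is supported within distance 1 of [x] for [k] even and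
    [m - 1] for [k] odd, which are exactly the increments of [level]. *)
Lemma of_small_vec_cfilt k x : of_small_vec k x \in cfilt x (level m k).
Proof.
elim: k x => [|k IH] x.
  by apply: cfilt_gen; rewrite slen_diag slen1.
rewrite of_small_vec_S cfilt_cone // of_small_lincomb // => z dz.
apply: cfilt_move (IH z); rewrite level_S addnC leq_add2l.
move: dz; rewrite !mxE; case: odd; first by rewrite cdist_le_pred.
have [->|_] := eqVneq z x; first by rewrite cdistxx.
have [<-|_] := eqVneq (ord_pred z) x; last by rewrite subrr eqxx.
by move=> _; rewrite -{2}(ord_predK z) cdist_ordS.
Qed.

Lemma of_small_cfilt k x p f :
  (forall z, f 0 z != 0 -> (cdist x z + level m k <= p)%N) ->
  of_small k f \in cfilt x p.
Proof.
move=> fP; apply: of_small_lincomb => z /fP zp.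
exact: cfilt_move (of_small_vec_cfilt k z).
Qed.

Lemma of_small_filt k f : of_small k f \in filt (level m k)%:Z.
Proof.
apply: rpred_sum => z _; apply: rpredZ.
exact: cfilt_filt (of_small_vec_cfilt k z).
Qed.

(** The summand [cdist x z] carries the induction. For [size u] even a contraction reaches only
    [z = x], from [ord_pred x] at distance [m - 1]; for [size u] odd it reaches [z] only from some
    [w] farther from [x]. *)
Lemma to_small_seq_supp x u z : (to_small_seq (x :: u)) 0 z != 0 ->
  (cdist x z + level m (size u) <= slen (x :: u))%N.
Proof.
elim: u x z => [|y u IH] x z.
  rewrite /= mxE eqxx /=; case: (z =P x) => [->|]; last by rewrite eqxx.
  by rewrite cdistxx slen1 /level muln0.
rewrite to_small_seq_cons // (_ : size (y :: u) = (size u).+1) //.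
rewrite slen_cons level_S mxE -pred_Sn; case: odd.
  case: (eqVneq z x) => [->|]; rewrite ?mul0r ?eqxx // mul1r => /IH.
  have := cdist_triangle y x (ord_pred x).
  by rewrite cdist_pred cdistxx; lia.
move=> sum_neq0.
have [w] : exists w,
    (cdist x z < cdist x w)%:R * to_small_seq (y :: u) 0 w != 0.
  apply/existsP; apply: contraNT sum_neq0; rewrite negb_exists => /forallP w0.
  by rewrite big1 // => w _; apply/eqP; have := w0 w; rewrite negbK.
case: ltnP => [zw|]; rewrite ?mul0r ?eqxx // mul1r => /IH.
by have := cdist_triangle y x w; lia.
Qed.

Lemma htpy_seq_cfilt x u :
  htpy_seq (size u).+1 (x :: u) \in cfilt x (slen (x :: u)).
Proof.
elim: u x => [|y u IH] x; rewrite htpy_seq_cons rpredN cfilt_cone // rpredD //.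
- by apply: of_small_cfilt => z; apply: to_small_seq_supp.
- exact: rpred0.
- by apply: of_small_cfilt => z; apply: to_small_seq_supp.
by apply: cfilt_move (IH y); rewrite slen_cons.
Qed.

Lemma htpy_filt (p : int) k (c : K k) : c \in filt p -> htpy c \in filt p.
Proof.
move=> /filtP cP; apply: rpred_sum => t _.
have [->|/cP tp] := eqVneq (c t) 0; first by rewrite scale0r rpred0.
apply: rpredZ; apply: filt_le tp _; have := size_verts t.
have [x [u ->]] := vertsE t => -[<-].
exact: cfilt_filt (htpy_seq_cfilt x u).
Qed.

(** Since C_k sits in a single level, respecting the filtration means killing everything below that
    level. *)
Lemma to_small_filt (p : int) k (c : K k) : c \in filt p ->
  p < (level m k)%:Z -> to_small c = 0.
Proof.
move=> /filtP cP pk; rewrite /to_small /ext big1 // => t _.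
have [->|/cP tp] := eqVneq (c t) 0; first by rewrite scale0r.
have [x [u tE]] := vertsE t; have ut : size u = k.
  by have := size_verts t; rewrite tE => -[].
rewrite (_ : to_small_seq _ = 0) ?scaler0 //; apply/rowP => z; rewrite [RHS]mxE.
apply/eqP; apply: contraTT pk => Fz; rewrite -leNgt; apply: le_trans tp.
by rewrite lez_nat; move: Fz; rewrite tE => /to_small_seq_supp; rewrite ut; lia.
Qed.

End CycleChains.

(** * The pages *)

Section Subquotients.
Variables (R : pzRingType) (V : lmodType R) (Z B : submodClosed V).

Lemma eq_sq_pi (u v : numer Z) :
  (sq_pi B u = sq_pi B v) <-> (numer_val u - numer_val v \in B).
Proof.
have -> : (numer_val u - numer_val v \in B) = (u - v \in @denom R V Z B).
  by rewrite inE -[numer_val (u - v)]/(val (u - v)) raddfB.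
exact: sq_piP.
Qed.

Lemma zero_subquotient : (forall c, c \in Z -> c \in B) ->
  zero_module (subquotient Z B).
Proof.
move=> ZB x; rewrite -[x]sq_reprK -[RHS]sq_reprK; apply/eq_sq_pi.
apply: rpredD; last rewrite -scaleN1r rpredZ //; apply: ZB; apply: valP.
Qed.

Lemma free_subquotient n (phi : {linear 'rV[R]_n -> V}) :
  (forall v, phi v \in Z) -> (forall v, phi v \in B -> v = 0) ->
  (forall c, c \in Z -> exists v, c - phi v \in B) ->
  free_of_rank n (subquotient Z B).
Proof.
move=> phiZ phi_inj phi_surj.
pose psi v : subquotient Z B := sq_pi B (Numer (phiZ v)).
have psi_lin : linear psi.
  move=> a u v; have -> : a *: psi u = sq_pi B (a *: Numer (phiZ u)).
    exact: sq_scale_pi.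
  rewrite -sq_piD; apply/eq_sq_pi.
  have -> : numer_val (a *: Numer (phiZ u) + Numer (phiZ v))
    = a *: phi u + phi v.
    by rewrite -[LHS]/(val (a *: Numer (phiZ u) + Numer (phiZ v))) linearP.
  by rewrite /= linearP subrr rpred0.
have psi_inj : injective psi.
  move=> u v /eq_sq_pi; rewrite /= -linearB => /phi_inj/eqP.
  by rewrite subr_eq0 => /eqP.
(* Boolean equality lets [xchoose] supply the inverse. *)
have psi_surj x : exists v, psi v == x.
  rewrite -[x]sq_reprK; have [v vP] := phi_surj _ (valP (sq_repr x)).
  by exists v; apply/eqP/eq_sq_pi; rewrite /= -opprB -scaleN1r rpredZ.
pose psiL := GRing.isLinear.Build R 'rV[R]_n (subquotient Z B) *:%R psi psi_lin.
pose f : {linear 'rV[R]_n -> subquotient Z B} := HB.pack psi psiL.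
exists f; exists (fun x => xchoose (psi_surj x)) => [v|x].
  by apply: psi_inj; apply/eqP; apply: (xchooseP (psi_surj (psi v))).
by apply/eqP; apply: (xchooseP (psi_surj x)).
Qed.

End Subquotients.

(** * Reduction of the pages to the periodic complex *)

Section Pages.
Variables (R : comPzRingType) (m : nat).
Hypothesis m_gt1 : (1 < m)%N.
Local Notation Zm := (directed_cycle m).
Local Notation K k := (RC R Zm (Posz k)).
Implicit Types (r k : nat) (p : int) (f g : 'rV[R]_m).

Lemma RC_neg0 j (c : RC R Zm (Negz j)) : c = 0.
Proof.
apply/ffunP => t; have := reach_verts t.
by rewrite (size0nil (size_verts t)).
Qed.

(** The free degree [n0] lets [k] stand for [k.+1 - 1] without a cast. *)
Lemma ss_numP r p n n0 (c : RC R Zm n) : n0 = n - 1 ->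
  (c \in ss_num R Zm r p n) <-> exists z w,
  [/\ z \in filt p, bd n0 z \in filt (p - r%:Z), w \in filt (p - 1)
    & c = z + w].
Proof. by move=> ->; split=> /asboolP. Qed.

Lemma ss_denP r p n n1 (c : RC R Zm n) : n1 = n + 1 ->
  (c \in ss_den R Zm r p n) <-> exists (z : RC R Zm n1) w,
  [/\ z \in filt (p + r%:Z - 1), bd n z \in filt p, w \in filt (p - 1)
    & c = bd n z + w].
Proof. by move=> ->; split=> /asboolP. Qed.

Lemma posz_succ k : k.+1%:Z = k%:Z + 1.
Proof. by rewrite intS addrC. Qed.

Lemma posz_pred k : k%:Z = k.+1%:Z - 1.
Proof. by rewrite posz_succ addrK. Qed.

Lemma ss_num_anti r r' p n (c : RC R Zm n) : (r <= r')%N ->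
  c \in ss_num R Zm r' p n -> c \in ss_num R Zm r p n.
Proof.
move=> rr' /(ss_numP _ _ _ (erefl (n - 1))) [z [w [zF dzF wF ->]]].
apply/(ss_numP _ _ _ (erefl (n - 1))); exists z, w; split=> //.
by apply: filt_le dzF; lia.
Qed.

Lemma ss_den_sub_num r r' p k (c : K k) :
  c \in ss_den R Zm r p k -> c \in ss_num R Zm r' p k.
Proof.
move=> /(ss_denP _ _ _ (posz_succ k)) [z [w [_ dzF wF ->]]].
apply/(ss_numP _ _ _ (erefl (k%:Z - 1))); exists (bd k z), w; split=> //.
case: k c z w dzF wF => [|k] _ z w _ _; first by rewrite [bd _ _]RC_neg0 rpred0.
by rewrite -(posz_pred k) bd_bd // rpred0.
Qed.

(** The homotopy formula splits the representative; its term [htpy (bd k z)] joins the part of level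
    [p - 1], because [bd k z] already lies there. *)
Lemma num1_split p k (c : K k) : c \in ss_num R Zm 1 p k ->
  exists f (y : K k.+1) w, [/\ y \in filt p, bd k y \in filt p,
    w \in filt (p - 1), c = of_small k f + bd k y + w
    & p < (level m k)%:Z -> f = 0].
Proof.
case: k c => [|k] c.
  move=> /(ss_numP _ _ _ (erefl _)) [z [w [zF _ wF ->]]].
  exists (to_small z), 0, w; rewrite !linear0 !rpred0 addr0 to_small0K.
  split=> //; exact: to_small_filt.
move=> /(ss_numP _ _ _ (posz_pred k)) [z [w [zF dzF wF ->]]].
have zE := homotopy m_gt1 z.
have HdzF : htpy (bd k z) \in filt (p - 1) by exact: htpy_filt.
have GFzF : of_small k.+1 (to_small z) \in filt p.
  have [/(to_small_filt m_gt1 zF) ->|lamp] := ltP p (level m k.+1)%:Z.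
    by rewrite linear0 rpred0.
  by apply: filt_le lamp _; apply: of_small_filt.
exists (to_small z), (htpy z), (w + htpy (bd k z)); split.
- exact: htpy_filt.
- have -> : bd k.+1 (htpy z) = z - of_small k.+1 (to_small z) - htpy (bd k z).
    by rewrite zE addrK.
  rewrite !rpredD ?rpredN //; apply: filt_le HdzF; lia.
- exact: rpredD.
- by rewrite addrA -addrA [w + _]addrC addrA -[_ + _ + htpy _]addrA -zE addrCA
  subrr addr0.
exact: to_small_filt.
Qed.

(** Off the level of C_k the summand [of_small k f] is negligible: below it [f = 0], and above it
    the summand lies in level [p - 1]. *)
Lemma num1_den r p k (c : K k) : (0 < r)%N -> p != (level m k)%:Z ->
  c \in ss_num R Zm 1 p k -> c \in ss_den R Zm r p k.
Proof.
move=> r_gt0 pk /num1_split [f [y [w [yF dyF wF -> f0]]]].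
apply/(ss_denP _ _ _ (posz_succ k)).
exists y, (of_small k f + w); split=> //.
- by apply: filt_le yF; lia.
- apply: rpredD => //; have [/f0 ->|kp] := ltP p (level m k)%:Z.
    by rewrite linear0 rpred0.
  by apply: filt_le (of_small_filt m_gt1 k f); move: pk; lia.
by rewrite addrA [bd _ _ + _]addrC.
Qed.

(* [num_cond] and [den_cond] describe the numerator and the denominator of the
   r-th page of C in the only filtration level that meets C_k. *)
Definition num_cond r k f :=
  if k is k'.+1 then (level m k' + r <= level m k)%N \/ small_bd k' f = 0
  else True.

Definition den_cond r k f :=
  exists g, f = small_bd k g /\ (g = 0 \/ (level m k.+1 < level m k + r)%N).

Lemma level_lt k : (level m k < level m k.+1)%N.
Proof. by rewrite level_S //; case: odd; lia. Qed.

Lemma num1_of_small k f : of_small k f \in ss_num R Zm 1 (level m k) k.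
Proof.
apply/(ss_numP _ _ _ (erefl (k%:Z - 1))); exists (of_small k f), 0.
rewrite of_small_filt // rpred0 addr0; split=> //.
case: k => [|k]; first by rewrite [bd _ _]RC_neg0 rpred0.
rewrite -(posz_pred k) bd_of_small //.
apply: filt_le (of_small_filt _ _ _) => //.
by have := level_lt k; lia.
Qed.

Lemma to_small_low (k : nat) (w : K k) :
  w \in filt ((level m k)%:Z - 1) -> to_small w = 0.
Proof. by move=> wF; apply: (to_small_filt m_gt1 wF); lia. Qed.

(** [to_small] kills [y] and [w], both too short for their degrees, so [f] can only be
    [to_small c]. *)
Lemma num1_split_level k (c : K k) : c \in ss_num R Zm 1 (level m k) k ->
  exists (y : K k.+1) w, [/\ y \in filt (level m k),
    bd k y \in filt (level m k), w \in filt ((level m k)%:Z - 1)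
    & c = of_small k (to_small c) + bd k y + w].
Proof.
move=> /num1_split [f [y [w [yF dyF wF cE _]]]]; exists y, w; split=> //.
have Fy : to_small y = 0.
  by apply: (to_small_filt m_gt1 yF); have := level_lt k; lia.
suff -> : to_small c = f by [].
by rewrite cE 2!linearD /= of_smallK // to_small_bd // Fy (to_small_low wF)
  linear0 !addr0.
Qed.

(** If [r] exceeds the drop in level, [bd] of the representative is so short that [to_small] kills
    it. Conversely [of_small] of [to_small c] plus a boundary is a suitable representative. *)
Lemma num_level r k (c : K k) : (0 < r)%N ->
  c \in ss_num R Zm r (level m k) k <->
  c \in ss_num R Zm 1 (level m k) k /\ num_cond r k (to_small c).
Proof.
move=> r_gt0; case: k c => [|k] c; split.
- by move=> cN; split=> //; apply: ss_num_anti cN.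
- move=> [/(ss_numP _ _ _ (erefl _)) [z [w [zF _ wF ->]]] _].
  apply/(ss_numP _ _ _ (erefl _)); exists z, w; split=> //.
  by rewrite [bd _ _]RC_neg0 rpred0.
- move=> cN; split; first exact: ss_num_anti cN.
  move: cN => /(ss_numP _ _ _ (posz_pred k)) [z [w [zF dzF wF ->]]].
  rewrite linearD /= (to_small_low wF) addr0 /num_cond.
  case: leqP => [_|small]; [by left | right].
  by rewrite -to_small_bd // (to_small_filt m_gt1 dzF) //; lia.
move=> [/num1_split_level [y [w [yF dyF wF cE]]] cond].
apply/(ss_numP _ _ _ (posz_pred k)).
exists (of_small k.+1 (to_small c) + bd k.+1 y), w.
split=> //; first by rewrite rpredD // of_small_filt.
rewrite linearD /= bd_bd // addr0 bd_of_small //; case: cond => [large|->].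
  by apply: filt_le (of_small_filt _ _ _) => //; lia.
by rewrite linear0 rpred0.
Qed.

Lemma den_level r k (c : K k) : (0 < r)%N ->
  c \in ss_den R Zm r (level m k) k <->
  c \in ss_num R Zm 1 (level m k) k /\ den_cond r k (to_small c).
Proof.
move=> r_gt0; split=> [cD|[]]; last first.
  move=> /num1_split_level [y [w [yF dyF wF cE]]] [g [Fc gP]].
  apply/(ss_denP _ _ _ (posz_succ k)); exists (of_small k.+1 g + y), w.
  rewrite linearD /= bd_of_small // -Fc; split=> //.
    apply: rpredD; last by apply: filt_le yF; lia.
    case: gP => [->|large]; first by rewrite linear0 rpred0.
    by apply: filt_le (of_small_filt _ _ _) => //; lia.
  by rewrite rpredD // of_small_filt.
split; first exact: ss_den_sub_num cD.
move: cD => /(ss_denP _ _ _ (posz_succ k)) [z [w [zF dzF wF ->]]].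
exists (to_small z); rewrite linearD /= to_small_bd // (to_small_low wF) addr0.
split=> //; case: ltnP => [_|large]; [by right | left].
by apply: (to_small_filt m_gt1 zF); lia.
Qed.

Lemma page_free n r (i j : int) k (psi : {linear 'rV[R]_n -> 'rV[R]_m}) :
  (0 < r)%N -> i = (level m k)%:Z -> i + j = k%:Z ->
  (forall v, num_cond r k (psi v)) ->
  (forall v, den_cond r k (psi v) -> v = 0) ->
  (forall f, num_cond r k f -> exists v, den_cond r k (f - psi v)) ->
  free_of_rank n (SS R Zm r i j).
Proof.
move=> r_gt0 -> ijk psiN psi_inj psi_surj; rewrite /SS.
(* The types depend on the degree, so it is generalized before being replaced by [k]. *)
move: (_ + j) ijk => _ ->.
apply: (@free_subquotient _ _ _ _ _ (@of_small R m k \o psi)%FUN) => [v|v|c].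
- by apply/num_level => //; rewrite num1_of_small of_smallK.
- by move=> /den_level[] // _; rewrite of_smallK //; apply: psi_inj.
move=> /num_level[] // c1 /psi_surj[v vP]; exists v; apply/den_level => //.
by rewrite linearB /= of_smallK // rpredB //= num1_of_small.
Qed.

Lemma page_zero r (i j : int) : (0 < r)%N ->
  (forall k f, i = (level m k)%:Z -> i + j = k%:Z ->
     num_cond r k f -> den_cond r k f) ->
  zero_module (SS R Zm r i j).
Proof.
move=> r_gt0; rewrite /SS; move: (i + j) => n cond.
apply: zero_subquotient; case: n cond => [k|k] cond c; last first.
  by rewrite [c]RC_neg0 !rpred0.
have [ik|ik] := eqVneq i (level m k)%:Z; last first.
  by move=> cN; apply: num1_den => //; apply: ss_num_anti cN.
rewrite ik => /num_level[] // c1 cN; apply/den_level => //.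
by split=> //; apply: cond.
Qed.

Lemma page_eq r r' p n : (0 < r)%N -> (0 < r')%N ->
  (forall k f, num_cond r k f <-> num_cond r' k f) ->
  (forall k f, den_cond r k f <-> den_cond r' k f) ->
  ss_num R Zm r p n =i ss_num R Zm r' p n
  /\ ss_den R Zm r p n =i ss_den R Zm r' p n.
Proof.
move=> r_gt0 r'_gt0 numE denE; case: n => [k|k]; last first.
  by split=> c; rewrite [c]RC_neg0 !rpred0.
have [->|pk] := eqVneq p (level m k)%:Z.
  split=> c; apply/idP/idP.
  - by move=> /num_level[] // ? /numE ?; apply/num_level.
  - by move=> /num_level[] // ? /numE ?; apply/num_level.
  - by move=> /den_level[] // ? /denE ?; apply/den_level.
  - by move=> /den_level[] // ? /denE ?; apply/den_level.
(* Off the level of C_k every numerator lies in every denominator, so all of them coincide. *)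
have sub s s' c : (0 < s)%N -> (0 < s')%N ->
    c \in ss_num R Zm s p k -> c \in ss_den R Zm s' p k.
  by move=> s_gt0 s'_gt0 cN; apply: num1_den => //; apply: ss_num_anti cN.
split=> c; apply/idP/idP => cP.
- by apply: (@ss_den_sub_num 1); apply: sub cP.
- by apply: (@ss_den_sub_num 1); apply: sub cP.
- by apply: (@sub 1); rewrite ?(ss_den_sub_num _ cP).
- by apply: (@sub 1); rewrite ?(ss_den_sub_num _ cP).
Qed.

End Pages.

Lemma level_double m i : level m (2 * i) = (m * i)%N.
Proof. by rewrite /level mul2n doubleK odd_double addn0. Qed.

Lemma level_doubleS m i : level m (2 * i + 1) = (m * i + 1)%N.
Proof. by rewrite /level addn1 mul2n /= odd_double uphalf_double. Qed.

Lemma even_or_odd k : exists i, k = (2 * i)%N \/ k = (2 * i + 1)%N.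
Proof.
exists k./2; have := odd_double_half k; rewrite -mul2n.
by case: odd => /= E; [right | left]; lia.
Qed.

(** * Ranks of the pages of the periodic complex *)

Section Ranks.
Variables (R : comPzRingType) (m : nat).
Hypothesis m_gt2 : (2 < m)%N.
Local Notation Zm := (directed_cycle m).
Implicit Types (r k : nat) (f : 'rV[R]_m).

Let m_gt1 : (1 < m)%N := ltnW m_gt2.
Let x0 : 'I_m := Ordinal (ltnW m_gt1).

Lemma den_cond0 r k : den_cond r k (0 : 'rV[R]_m).
Proof. by exists 0; rewrite linear0; split; [|left]. Qed.

Lemma small_bd_cone_even k f : ~~ odd k ->
  small_bd k (small_cone k x0 f) = f - (\sum_y f 0 y) *: delta_mx 0 x0.
Proof.
move=> /negPf k_even; rewrite -small_cone_bd0.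
by apply/rowP => z; rewrite !mxE k_even.
Qed.

(** The differential leaving a positive even degree is the norm, which drops the level by
    [m - 1]. *)
Lemma num_cond_even r k f : ~~ odd k -> (r < m)%N -> num_cond r k f.
Proof.
case: k => //= k /negPn k_odd r_lt; left; rewrite level_S // k_odd; lia.
Qed.

(** Exactness: the kernel of t - 1 is the image of the norm. *)
Lemma ker_small_bd_even k f : ~~ odd k -> small_bd k f = 0 ->
  f = small_bd k.+1 (small_cone k.+1 x0 f).
Proof.
by move=> k_even df; rewrite -[LHS](small_cone_bd k x0) df linear0 addr0.
Qed.

(** Both differentials lower the level strictly, so on the first page every vector survives and only
    0 is divided out. *)
Lemma MH_free k (i j : int) : i = (level m k)%:Z -> i + j = k%:Z ->
  free_of_rank m (SS R Zm 1 i j).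
Proof.
move=> iE ijE; apply: (page_free m_gt1 (psi := idfun) _ iE ijE) => // [v|v|f _].
- by case: k {iE ijE} => //= k; left; rewrite addn1 level_lt.
- case=> g [/= -> [->|]]; first by rewrite linear0.
  by have := level_lt m_gt1 k; lia.
by exists f; rewrite subrr; apply: den_cond0.
Qed.

(** The page is the cokernel of t - 1, detected by the sum of coordinates and generated by one basis
    vector. Assuming [num_cond] rather than [r < m] covers also [r = m] in degree 0. *)
Lemma page_free_even r k (i j : int) : ~~ odd k -> (1 < r)%N ->
  (forall f, num_cond r k f) -> i = (level m k)%:Z -> i + j = k%:Z ->
  free_of_rank 1 (SS R Zm r i j).
Proof.
move=> k_even r_gt1 num_r iE ijE.
pose psi : {linear 'rV[R]_1 -> 'rV[R]_m} := mulmxr (delta_mx 0 x0).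
apply: (page_free m_gt1 (psi := psi) _ iE ijE) => // [|v|f _].
- exact: ltnW.
- case=> g [vE _]; apply/rowP => z; rewrite ord1 [RHS]mxE.
  rewrite -(sum_small_bd_even g k_even) -vE /= -(mulr1 (v 0 0)).
  rewrite -(sum_delta_mx _ x0).
  by rewrite mulr_sumr; apply: eq_bigr => y _; rewrite [RHS]mxE big_ord1.
exists (\sum_y f 0 y)%:M, (small_cone k x0 f); split.
  by rewrite small_bd_cone_even //= mul_scalar_mx.
by right; rewrite level_S // (negPf k_even); lia.
Qed.

(** The numerator is the kernel of t - 1, that is, the constant vectors; the norm drops too far to
    contribute to the denominator while [r < m]. *)
Lemma page_free_odd r k (i j : int) : odd k -> (1 < r < m)%N ->
  i = (level m k)%:Z -> i + j = k%:Z -> free_of_rank 1 (SS R Zm r i j).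
Proof.
case: k => // k /= k_even /andP[r_gt1 r_lt] iE ijE.
apply: (page_free m_gt1 (psi := mulmxr (const_mx 1)) _ iE ijE) => [|v|v|f].
- exact: ltnW.
- right; apply/rowP => z; rewrite !mxE (negPf k_even).
  by rewrite !big_ord1 !mxE subrr.
- case=> g [vE gP]; apply/rowP => z; rewrite ord1 [RHS]mxE.
  have {}gP : g = 0 by case: gP => //; rewrite level_S //= k_even; lia.
  by have /rowP/(_ x0) := vE; rewrite gP linear0 !mxE big_ord1 mxE mulr1.
case; first by rewrite level_S // (negPf k_even); lia.
move=> /(ker_small_bd_even k_even) fE.
exists (\sum_y (small_cone k.+1 x0 f) 0 y)%:M.
rewrite (_ : _ - _ = 0); first exact: den_cond0.
rewrite [X in X - _]fE; apply/rowP => z /=.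
by rewrite mul_scalar_mx !mxE /= k_even mulr1 subrr.
Qed.

End Ranks.

Theorem theorem8p2 (R : comPzRingType) (m : nat) (hm : (3 <= m)%N) :
  let Zm := directed_cycle m in
  [/\ (forall i : nat,
         free_of_rank m (MH R Zm (2 * i)%N%:Z (m * i)%N%:Z)
         /\ free_of_rank m (MH R Zm (2 * i + 1)%N%:Z (m * i + 1)%N%:Z)),
      (forall i : nat,
         free_of_rank 1 (PH R Zm (2 * i)%N%:Z (m * i)%N%:Z)
         /\ free_of_rank 1 (PH R Zm (2 * i + 1)%N%:Z (m * i + 1)%N%:Z)),
      (forall k l : int,
         (forall i : nat,
            (k, l) <> ((2 * i)%N%:Z, (m * i)%N%:Z)
            /\ (k, l) <> ((2 * i + 1)%N%:Z, (m * i + 1)%N%:Z)) ->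
         zero_module (MH R Zm k l) /\ zero_module (PH R Zm k l)),
      (forall (r : nat) (i j : int), (2 <= r <= m - 1)%N ->
         ss_num R Zm r i (i + j) =i ss_num R Zm 2 i (i + j)
         /\ ss_den R Zm r i (i + j) =i ss_den R Zm 2 i (i + j))
    & free_of_rank 1 (SS R Zm m 0 0)
      /\ (forall i j : int, (i, j) <> (0, 0) -> zero_module (SS R Zm m i j))].
Proof.
have m_gt1 := ltnW hm; move=> Zm; split.
- move=> i; split.
    by apply: (MH_free R hm (k := 2 * i)); rewrite ?level_double ?subrKC.
  by apply: (MH_free R hm (k := 2 * i + 1)); rewrite ?level_doubleS ?subrKC.
- move=> i; split.
    apply: (page_free_even hm (k := 2 * i)); rewrite ?level_double ?subrKC //.
      by rewrite mul2n odd_double.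
    by move=> f; apply: num_cond_even; rewrite // mul2n odd_double.
  apply: (page_free_odd R hm (k := 2 * i + 1));
    rewrite ?level_doubleS ?subrKC //.
    by rewrite addn1 mul2n /= odd_double.
(* [page_zero] only leaves the bidegrees that meet some C_n, and the parity of [n] puts them among
   the excluded ones. *)
- move=> k l kl; split; apply: page_zero => // n f; rewrite subrKC => lE kE.
    by have [i [nE|nE]] := even_or_odd n; have [] := kl i;
      rewrite kE lE nE ?level_double ?level_doubleS.
  by have [i [nE|nE]] := even_or_odd n; have [] := kl i;
    rewrite kE lE nE ?level_double ?level_doubleS.
(* The drops in level are 1 and [m - 1], so every [r] in this range separates them as 2 does. *)
- move=> r i j /andP[r_gt1 r_lt]; apply: page_eq => // [|[|k] f|k f].
  + exact: ltnW.
  + by [].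
  + rewrite /num_cond (_ : (_ <= _)%N = (level m k + 2 <= level m k.+1)%N) //.
    by rewrite level_S //; case: odd; lia.
  rewrite /den_cond (_ : (_ < _ + r)%N = (level m k.+1 < level m k + 2)%N) //.
  by rewrite level_S //; case: odd; lia.
split.
  by apply: (page_free_even hm (k := 0)) => //; rewrite /level muln0.
(* Both drops are below [m], so in positive degrees the page is kernel modulo image, and the
   contraction makes it 0. *)
move=> i j ij; apply: page_zero => // [|[|k] f iE ijE]; first exact: ltnW.
  by case: ij; move: ijE; rewrite iE /level muln0 add0r => ->.
case=> [|df]; first by rewrite level_S //; case: odd; lia.
exists (small_cone k.+1 (Ordinal (ltnW m_gt1)) f); split.
  by rewrite -[LHS](small_cone_bd k (Ordinal (ltnW m_gt1))) df linear0 addr0.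
by right; rewrite [level m k.+2]level_S // ltn_add2l; case: ifP; lia.
Qed.
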